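(* Let $\lambda\in\mathbb{R}$, let $Y$ be a random variable whose moment generating function exists in a neighborhood of the origin, and let $x\in[0,1]$. For all integers $n\ge k\ge 0$, \[ B_{k,n}^{Y}(x|\lambda)=(x)_{k,\lambda}\sum_{m=k}^{n}\binom{n}{m}{m \brace k}_{Y,\lambda}\,\beta_{n-m,\lambda}^{(k,Y)}(1-x). \]
   Context: For $\lambda\in\mathbb{R}$, $(x)_{0,\lambda}=1$, $(x)_{n,\lambda}=x(x-\lambda)\cdots(x-(n-1)\lambda)$ for $n\ge1$, and $e_\lambda^x(t)=\sum_{n\ge0}(x)_{n,\lambda}\frac{t^n}{n!}$. For the random variable $Y$, $E[e_\lambda^Y(t)]$ denotes the power series $\sum_{n\ge0}E[(Y)_{n,\lambda}]\frac{t^n}{n!}$ (constant term $1$); for real $a$, $(E[e_\lambda^Y(t)])^a=\sum_{j\ge0}\binom{a}{j}(E[e_\lambda^Y(t)]-1)^j$. The probabilistic degenerate Stirling numbers of the second kind: $\frac{1}{k!}(E[e_\lambda^Y(t)]-1)^k=\sum_{n\ge k}{n\brace k}_{Y,\lambda}\frac{t^n}{n!}$. The probabilistic degenerate Bernoulli polynomials of order $r\in\mathbb{N}\cup\{0\}$: $\Big(\frac{t}{E[e_\lambda^Y(t)]-1}\Big)^r\big(E[e_\lambda^Y(t)]\big)^x=\sum_{n\ge0}\beta_{n,\lambda}^{(r,Y)}(x)\frac{t^n}{n!}$. The probabilistic degenerate Bernstein polynomials: $\frac{1}{k!}(x)_{k,\lambda}t^k(E[e_\lambda^Y(t)])^{1-x}=\sum_{n\ge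 k}B_{k,n}^{Y}(x|\lambda)\frac{t^n}{n!}$.
   Formalization: For k ≥ 1 it is additionally assumed that E[Y] ≠ 0; otherwise t/(E[e_λ^Y(t)]−1) is not a power series and the Bernoulli polynomials of order k are undefined. *)

(* Defs.v *)
From HB Require Import structures.
From mathcomp Require Export all_boot all_order all_algebra.
From mathcomp Require Export all_classical all_reals all_analysis.

Set Implicit Arguments.
Unset Strict Implicit.
Unset Printing Implicit Defensive.

Import Order.TTheory GRing.Theory Num.Theory.
Import numFieldNormedType.Exports.

Local Open Scope ring_scope.

(* A formal power series sum_n f_n t^n is represented by its sequence of
   (ordinary) coefficients f : nat -> R.  The pointwise ring structure that
   nat -> R carries in the library has the wrong product, so the Cauchy product
   and what is built on it are given separate names. *)
Section FormalPowerSeries.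
Variable R : fieldType.
Implicit Types (f g u : nat -> R) (a c x : R) (n k r : nat).

Definition fps1 : nat -> R := fun n => (n == 0%N)%:R.

Definition fpsX k : nat -> R := fun n => (n == k)%:R.

Definition fps_sub f g : nat -> R := fun n => f n - g n.

Definition fps_scale c f : nat -> R := fun n => c * f n.

Definition fps_mul f g : nat -> R := fun n => \sum_(i < n.+1) f i * g (n - i)%N.

Definition fps_exp f k : nat -> R := iter k (fps_mul f) fps1.

(* sum_(j >= 0) g_j u^j, for u with zero constant term: u^j then only has terms
   of degree >= j, so the coefficient of t^n is the sum over j <= n. *)
Definition fps_comp g u : nat -> R :=
  fun n => \sum_(j < n.+1) g j * fps_exp u j n.

(* f^-1 = c^-1 * sum_j (1 - f / c)^j with c = f_0; meaningful when f_0 != 0. *)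
Definition fps_inv f : nat -> R :=
  fps_scale (f 0%N)^-1
    (fps_comp (fun=> 1) (fps_sub fps1 (fps_scale (f 0%N)^-1 f))).

(* f / t, for f with zero constant term. *)
Definition fps_divX f : nat -> R := fun n => f n.+1.

Definition gbinom a k : R := (\prod_(i < k) (a - i%:R)) / k`!%:R.

(* f^a = sum_j binom(a, j) (f - 1)^j, for f with constant term 1. *)
Definition fps_rpow f a : nat -> R := fps_comp (gbinom a) (fps_sub f fps1).

(* The coefficient of t^n / n!. *)
Definition egf_coef f n : R := n`!%:R * f n.

Definition deg_falling lambda x n : R := \prod_(i < n) (x - i%:R * lambda).

End FormalPowerSeries.

Section Probabilistic.
Context {d : measure_display} {T : measurableType d} {R : realType}.
Variables (P : probability T R) (Y : T -> R) (lambda : R).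
Implicit Types (n k r : nat) (x : R).

(* E[e_lambda^Y(t)] *)
Definition Edegexp : nat -> R :=
  fun n => fine 'E_P[fun w => deg_falling lambda (Y w) n] / n`!%:R.

Definition stirling2Y n k : R :=
  egf_coef (fps_scale k`!%:R^-1 (fps_exp (fps_sub Edegexp (fps1 R)) k)) n.

(* t / (E[e_lambda^Y(t)] - 1) is the inverse of (E[e_lambda^Y(t)] - 1) / t,
   whose constant term is E[Y]; hence for r > 0 the definition is meaningful
   only when E[Y] != 0. *)
Definition bernoulliY r n x : R :=
  egf_coef
    (fps_mul (fps_exp (fps_inv (fps_divX (fps_sub Edegexp (fps1 R)))) r)
             (fps_rpow Edegexp x)) n.

Definition bernsteinY k n x : R :=
  egf_coef
    (fps_scale (k`!%:R^-1 * deg_falling lambda x k)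
       (fps_mul (fpsX R k) (fps_rpow Edegexp (1 - x)))) n.

End Probabilistic.

(* Main.v *)
Require Import Defs.
From mathcomp Require Import lra measurable_realfun.
Import Order.TTheory GRing.Theory Num.Theory.
Import numFieldNormedType.Exports.
Local Open Scope classical_set_scope.
Local Open Scope ring_scope.

(** Put u = E[e_lambda^Y(t)] - 1, a power series without constant term, with
linear coefficient E[Y].  When E[Y] is finite and nonzero, u / t is invertible
and t^k = u^k (t / u)^k, so the generating series of the Bernstein polynomials
is (x)_{k,lambda} times the product of those of the Stirling numbers and of the
Bernoulli polynomials of order k; the formula is the comparison of the
coefficients of t^n / n!.  The moment generating function only serves to make
E[Y] finite. *)

Section FormalPowerSeriesTheory.
Set Implicit Arguments.
Unset Strict Implicit.
Variable R : fieldType.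
Implicit Types (f g h u v : nat -> R) (n k : nat).

(** A coefficient of a Cauchy product depends on finitely many terms, so truncation to polynomials
    transfers the ring laws of [{poly R}]. *)
Lemma fps_mul_coefM f g N n : (n < N)%N ->
  fps_mul f g n = (\poly_(i < N) f i * \poly_(i < N) g i)`_n.
Proof.
move=> ltnN; rewrite coefM; apply: eq_bigr => i _.
by rewrite !coef_poly !ifT // (leq_ltn_trans _ ltnN) ?leq_subr // -ltnS.
Qed.

Lemma fps_mulC : commutative (@fps_mul R).
Proof.
move=> f g; apply/funext=> n.
by rewrite !(fps_mul_coefM _ _ (ltnSn n)) mulrC.
Qed.

Lemma fps_mulA : associative (@fps_mul R).
Proof.
move=> f g h; apply/funext=> n.
pose p f := \poly_(i < n.+1) f i : {poly R}.
have pE f' i : (i <= n)%N -> f' i = (p f')`_i by rewrite coef_poly ltnS => ->.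
transitivity ((p f * (p g * p h))`_n).
  rewrite coefM; apply: eq_bigr => i _; rewrite -pE ?leq_ord //.
  by rewrite (@fps_mul_coefM _ _ n.+1) // ltnS leq_subr.
rewrite mulrA coefM; apply: eq_bigr => i _; rewrite -(pE h) ?leq_subr //.
by rewrite -(@fps_mul_coefM _ _ n.+1).
Qed.

Lemma fps_mul1 f : fps_mul (fps1 R) f = f.
Proof.
apply/funext=> n; rewrite /fps_mul big_ord_recl /fps1 mul1r subn0 big1 ?addr0 //.
by move=> i _; rewrite mul0r.
Qed.

Lemma fps_expS f k : fps_exp f k.+1 = fps_mul f (fps_exp f k).
Proof. by []. Qed.

Lemma fps_expM f g k :
  fps_exp (fps_mul f g) k = fps_mul (fps_exp f k) (fps_exp g k).
Proof.
elim: k => [|k IHk]; first by rewrite fps_mul1.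
rewrite !fps_expS IHk -!fps_mulA.
by congr fps_mul; rewrite !fps_mulA (fps_mulC g).
Qed.

Lemma fps_exp1 k : fps_exp (fps1 R) k = fps1 R.
Proof. by elim: k => // k IHk; rewrite fps_expS fps_mul1. Qed.

Lemma fps_mulX f n :
  fps_mul (fpsX R 1) f n = if n is n'.+1 then f n' else 0.
Proof.
rewrite /fps_mul; case: n => [|n]; first by rewrite big_ord1 mul0r.
rewrite 2!big_ord_recl mul0r add0r mul1r subn1 big1 ?addr0 // => i _.
by rewrite mul0r.
Qed.

Lemma fps_expX k : fps_exp (fpsX R 1) k = fpsX R k.
Proof.
elim: k => // k IHk; apply/funext=> -[|n];
by rewrite fps_expS fps_mulX // IHk /fpsX eqSS.
Qed.

Lemma fps_divXK u : u 0%N = 0 -> fps_mul (fpsX R 1) (fps_divX u) = u.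
Proof. by move=> u0; apply/funext=> -[|n]; rewrite fps_mulX. Qed.

Lemma fps_exp_low u k n : u 0%N = 0 -> (n < k)%N -> fps_exp u k n = 0.
Proof.
move=> u0; elim: k n => // k IHk n; rewrite ltnS => le_nk.
rewrite fps_expS /fps_mul big_ord_recl u0 mul0r add0r.
rewrite big1 // => i _; rewrite IHk ?mulr0 //= /bump /=.
by rewrite (leq_trans _ le_nk) // ltn_subrL /= (leq_ltn_trans (leq0n i)).
Qed.

(** In degree n the sum of the w^j telescopes to 1 - w^(n+1), and w^(n+1) has no term of degree
    n. *)
Lemma fps_geometric w : w 0%N = 0 ->
  fps_mul (fps_sub (fps1 R) w) (fps_comp (fun=> 1) w) = fps1 R.
Proof.
(* A truncation bound common to all degrees up to n, so that the two sums can be exchanged. *)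
move=> w0; have compE n N : (n < N)%N ->
    fps_comp (fun=> 1) w n = \sum_(j < N) fps_exp w j n.
  move=> ltnN; rewrite /fps_comp (big_ord_widen N (fun j => 1 * fps_exp w j n)) //.
  rewrite big_mkcond; apply: eq_bigr => j _; rewrite ltnS mul1r.
  by case: leqP => // /(fps_exp_low w0) ->.
apply/funext=> n; rewrite /fps_mul.
transitivity (\sum_(i < n.+1) \sum_(j < n.+1)
    ((fps1 R i) * fps_exp w j (n - i)%N - w i * fps_exp w j (n - i)%N)).
  apply: eq_bigr => i _; rewrite (compE _ n.+1) ?ltnS ?leq_subr // mulr_sumr.
  by apply: eq_bigr => j _; rewrite mulrBl.
rewrite exchange_big /=.
transitivity (\sum_(0 <= j < n.+1) (fps_exp w j n - fps_exp w j.+1 n)).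
  rewrite big_mkord; apply: eq_bigr => j _; rewrite sumrB; congr (_ - _).
  exact: (congr1 (@^~ n) (fps_mul1 (fps_exp w j))).
transitivity (- fps_exp w n.+1 n - - fps_exp w 0 n); last first.
  by rewrite (fps_exp_low w0) // opprK oppr0 add0r.
rewrite -(telescope_sumr (fun j => - fps_exp w j n) (leq0n n.+1)).
by apply: eq_bigr => j _; rewrite opprK addrC.
Qed.

(** With c = f_0 and w = 1 - f / c, one has f = c (1 - w), and the geometric series in w inverts 1 -
    w. *)
Lemma fps_mulV f : f 0%N != 0 -> fps_mul f (fps_inv f) = fps1 R.
Proof.
move=> f0; set w := fps_sub (fps1 R) (fps_scale (f 0%N)^-1 f).
have w0 : w 0%N = 0 by rewrite /w /fps_sub /fps_scale mulVf // subrr.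
rewrite -(fps_geometric w0); apply/funext=> n; apply: eq_bigr => i _.
by rewrite /fps_inv /fps_scale /w /fps_sub /fps_scale opprB addrC subrK mulrCA mulrA.
Qed.

(** Factor u = t (u / t); the k-th powers of u / t and of its inverse cancel. For k = 0 both sides
    are 1, whatever [u 1] is. *)
Lemma fps_exp_divX_inv u k : u 0%N = 0 -> ((0 < k)%N -> u 1%N != 0) ->
  fps_mul (fps_exp u k) (fps_exp (fps_inv (fps_divX u)) k) = fpsX R k.
Proof.
case: k => [|k] u0 u1; first by rewrite fps_mul1.
rewrite -{1}(fps_divXK u0) fps_expM fps_expX -fps_mulA -fps_expM.
by rewrite fps_mulV ?u1 // fps_exp1 fps_mulC fps_mul1.
Qed.

End FormalPowerSeriesTheory.

(** Binomial convolution, from n! = C(n, m) m! (n - m)!. *)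
Lemma egf_coefM (R : numFieldType) (f g : nat -> R) n :
  egf_coef (fps_mul f g) n =
  \sum_(0 <= m < n.+1) 'C(n, m)%:R * egf_coef f m * egf_coef g (n - m)%N.
Proof.
rewrite /egf_coef /fps_mul big_mkord mulr_sumr; apply: eq_bigr => m _.
rewrite -(bin_fact (leq_ord m)) !natrM.
by rewrite !mulrA; congr (_ * _); rewrite -!mulrA; do 2!congr (_ * _); rewrite mulrC.
Qed.

Section ExpectationFinite.
Set Implicit Arguments.
Unset Strict Implicit.
Context {d : measure_display} {T : measurableType d} {R : realType}.
Variables (P : probability T R) (Y : {RV P >-> R}).

Lemma mmt_gen_fun_integrable (t : R) : (mmt_gen_fun P Y t < +oo)%E ->
  P.-integrable setT (EFin \o (expR \o t \o* Y)).
Proof.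
rewrite /mmt_gen_fun unlock => Mt; apply/integrableP; split.
  by apply/measurable_EFinP; apply: measurableT_comp.
by under eq_integral do rewrite /= ger0_norm ?expR_ge0//.
Qed.

Lemma mmt_gen_fun_expectation_fin_num :
  (\forall t \near (0 : R), (mmt_gen_fun P Y t < +oo)%E) ->
  'E_P[Y]%E \is a fin_num.
Proof.
(* Half the radius puts both t and -t inside the open ball. *)
move=> /nbhs_ballP[e /= e0 eM]; pose t := e / 2.
have t0 : 0 < t by rewrite divr_gt0.
have te : t < e by rewrite /t ltr_pdivrMr// ltr_pMr// ltr1n.
have iE s : `|s| = t -> P.-integrable setT (EFin \o (expR \o s \o* Y)).
  move=> st; apply: mmt_gen_fun_integrable; apply: eM.
  by rewrite /ball/= sub0r normrN st.
rewrite unlock; apply: integrable_fin_num => //.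
(* |t Y| <= e^{tY} + e^{-tY} *)
have := integrableZl measurableT t^-1 (integrableD measurableT
  (iE t (gtr0_norm t0)) (iE (- t) (etrans (normrN t) (gtr0_norm t0)))).
apply: le_integrable => //; first exact/measurable_EFinP.
move=> w _ /=; rewrite lee_fin [leRHS]ger0_norm; last first.
  by rewrite mulr_ge0 ?invr_ge0 ?addr_ge0 ?expR_ge0 ?ltW.
rewrite mulrC ler_pdivlMr// -[t in leLHS](gtr0_norm t0) -normrM.
(* The bound follows from 1 + s <= e^s at s = tY and s = -tY, with both exponentials nonnegative. *)
have e1 := expR_ge1Dx (Y w * t); have e2 := expR_ge1Dx (Y w * - t).
have p1 := expR_ge0 (Y w * t); have p2 := expR_ge0 (Y w * - t).
by rewrite ler_norml; apply/andP; split; move: e1 e2 p1 p2; rewrite ?mulrN; lra.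
Qed.

End ExpectationFinite.

Theorem theorem2p2 (R : realType) (d : measure_display) (T : measurableType d)
    (P : probability T R) (Y : {RV P >-> R}) (lambda x : R) (k n : nat)
    (hmgf : \forall t \near (0 : R), (mmt_gen_fun P Y t < +oo)%E)
    (hx : 0 <= x <= 1)
    (hkn : (k <= n)%N)
    (* the Bernoulli polynomials of order k are defined *)
    (hEY : (0 < k)%N -> 'E_P[Y]%E <> 0%:E) :
  bernsteinY P Y lambda k n x =
  deg_falling lambda x k *
    \sum_(k <= m < n.+1)
      'C(n, m)%:R * stirling2Y P Y lambda m k
                  * bernoulliY P Y lambda k (n - m)%N (1 - x).
Proof.
set u := fps_sub (Edegexp P Y lambda) (fps1 R).
have u0 : u 0%N = 0.
  rewrite /u /fps_sub /Edegexp.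
  under [X in expectation _ X]eq_fun do rewrite /deg_falling big_ord0.
  by rewrite expectation_cst /= divr1 subrr.
have u1 : (0 < k)%N -> u 1%N != 0.
  move=> /hEY EY0; rewrite /u /fps_sub /Edegexp.
  under [X in expectation _ X]eq_fun do rewrite /deg_falling big_ord1 mul0r subr0.
  rewrite divr1 subr0; apply/eqP => fEY0; apply: EY0.
  (* [fine] also sends infinite values to 0; finiteness of E[Y] excludes that case. *)
  by rewrite -(fineK (mmt_gen_fun_expectation_fin_num hmgf)) fEY0.
rewrite /bernsteinY -(fps_exp_divX_inv u0 u1) -fps_mulA.
(* [G] is the generating series of the Bernoulli polynomials of order k at 1 - x. *)
set G := fps_mul (fps_exp (fps_inv _) k) _.
have -> : egf_coef (fps_scale (k`!%:R^-1 * deg_falling lambda x k)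
      (fps_mul (fps_exp u k) G)) n =
    deg_falling lambda x k *
      egf_coef (fps_mul (fps_scale k`!%:R^-1 (fps_exp u k)) G) n.
  rewrite /egf_coef /fps_scale /fps_mul [RHS]mulrCA; congr (_ * _).
  rewrite [_^-1 * _]mulrC -mulrA mulr_sumr; congr (_ * _).
  by apply: eq_bigr => i _; rewrite mulrA.
(* The terms with m < k vanish, since u^k starts in degree k. *)
rewrite egf_coefM (big_cat_nat (n := k)) ?leqW //= big1_seq ?add0r // => m.
rewrite mem_index_iota => /andP[_ /= ltmk].
by rewrite /egf_coef /fps_scale (fps_exp_low u0 ltmk) !(mulr0, mul0r).
Qed.
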